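(* Every $2$-spherical, thick twin building which satisfies Condition (co) is wall-connected.
   Context: **Coxeter systems.** $(W,S)$ is a Coxeter system with $S$ finite and length function $\ell$. $J\subseteq S$ is spherical if $\langle J\rangle$ is finite; then $r_J$ is the longest element of $\langle J\rangle$. A (twin) building of type $(W,S)$ is $2$-spherical if $o(st)<\infty$ for all $s,t\in S$. **Buildings.** A building of type $(W,S)$ is a pair $(\mathcal C,\delta)$, $\mathcal C\ne\emptyset$, $\delta:\mathcal C\times\mathcal C\to W$, such that for $x,y\in\mathcal C$, $w=\delta(x,y)$: (1) $w=1$ iff $x=y$; (2) if $\delta(y,z)=s\in S$ then $\delta(x,z)\in\{w,ws\}$, and $\delta(x,z)=ws$ if $\ell(ws)=\ell(w)+1$; (3) for $s\in S$ there is $z$ with $\delta(y,z)=s$, $\delta(x,z)=ws$. The $J$-residue of $x$ is $R_J(x)=\{y\mid\delta(x,y)\in\langle J\rangle\}$ (type $J$, rank $|J|$; spherical if $J$ is); panels are residues of rank $1$, $\mathcal P_s(x):=R_{\{s\}}(x)$. Thick: every panel has at least three chambers. Inside a spherical residue $R$ of type $J$, chambers $x,y$ are opposite in $R$ if $\delta(x,y)=r_J$; residues $R_1,R_2\subseteq R$ of types $J_1,J_2$ are opposite in $R$ if some chamber of $R_1$ is opposite in $R$ to some chamber of $R_2$ and $J_1=r_JJ_2r_J$. **Twin buildings.** A twin building of type $(W,S)$ is $\Delta=(\Delta_+,\Delta_-,\delta_* )$ with $\Delta_\pm=(\mathcal C_\pm,\delta_\pm)$ buildings of type $(W,S)$ and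 $\delta_*:(\mathcal C_+\times\mathcal C_-)\cup(\mathcal C_-\times\mathcal C_+)\to W$ such that for $\epsilon\in\{+,-\}$, $x\in\mathcal C_\epsilon$, $y\in\mathcal C_{-\epsilon}$, $w=\delta_*(x,y)$: $\delta_*(y,x)=w^{-1}$; if $\delta_{-\epsilon}(y,z)=s\in S$ and $\ell(ws)=\ell(w)-1$, then $\delta_*(x,z)=ws$; for $s\in S$ there is $z\in\mathcal C_{-\epsilon}$ with $\delta_{-\epsilon}(y,z)=s$, $\delta_*(x,z)=ws$. Put $\mathcal C=\mathcal C_+\cup\mathcal C_-$. Thick means both halves are thick. Chambers $x\in\mathcal C_\epsilon,y\in\mathcal C_{-\epsilon}$ are opposite if $\delta_*(x,y)=1$; $x^{\mathrm{op}}=\{y\in\mathcal C_{-\epsilon}\mid\delta_*(x,y)=1\}$. Residues in different halves are opposite if they have the same type and contain a pair of opposite chambers. **Condition (co).** $\Delta$ satisfies Condition (co) if for every $\epsilon\in\{+,-\}$ and every $c\in\mathcal C_\epsilon$, any two chambers of $c^{\mathrm{op}}$ can be joined by a sequence $(c_0,\dots,c_k)$ of chambers all in $c^{\mathrm{op}}$ such that for each $i$ there is $s\in S$ with $\delta_{-\epsilon}(c_{i-1},c_i)\in\langle s\rangle$. **Projections.** For a residue $R$ and a chamber $x$ in the same half, $\mathrm{proj}_Rx$ is the unique $z\in R$ with $\ell(\delta(x,y))=\ell(\delta(x,z))+\ell(\delta(z,y))$ for all $y\in R$. For $R$ spherical and $x$ in the other half, it is the unique $z\in R$ with $\ell(\delta_*(x,y))=\ell(\delta_*(x,z))-\ell(\delta(z,y))$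 for all $y\in R$. For a set $X$ of chambers, $\mathrm{proj}_RX=\{\mathrm{proj}_Rx\mid x\in X\}$. **Compatible paths.** Two panels $P,Q$ of one half are adjacent if they are opposite in some (spherical) rank $2$ residue, which is then unique and denoted $R(P,Q)$. A sequence $(P_0,\dots,P_k)$ of panels of one half with consecutive panels adjacent is a compatible path if $\mathrm{proj}_{R(P_{i-1},P_i)}P_0=P_{i-1}$ for $1\le i\le k$; its length is $k$ and its type is $(J_1,\dots,J_k)$, $J_i$ the type of $R(P_{i-1},P_i)$. For a panel $P$ in the other half, a compatible path $(P_0,\dots,P_k)$ is $P$-compatible if $P_0$ is opposite to $P$ and $\mathrm{proj}_{R(P_{i-1},P_i)}P=P_i$ for $1\le i\le k$. **Wall-connected.** For $c\in\mathcal C_\epsilon$, $s\in S$, let $\Gamma_s(c)$ be the graph whose vertices are the panels of $\mathcal C_{-\epsilon}$ opposite to $\mathcal P_s(c)$, where $Q_1,Q_2$ are joined by an edge if there are a panel $T\subseteq\mathcal C_{-\epsilon}$ and $\mathcal P_s(c)$-compatible paths from $Q_1$ to $T$ and from $Q_2$ to $T$ of the same length and type. $\Delta$ is wall-connected if $\Gamma_s(c)$ is connected for all $(c,s)\in\mathcal C\times S$. *)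

(* Defs.v *)
From mathcomp Require Import all_boot.
From mathcomp Require Import boolp classical_sets functions cardinality.

Set Implicit Arguments.
Unset Strict Implicit.
Unset Printing Implicit Defensive.

Local Open Scope classical_set_scope.
Local Open Scope group_scope.

(** * Coxeter systems *)

Definition has_order (G : groupType) (x : G) (n : nat) : Prop :=
  [/\ (0 < n)%N, x ^+ n = 1 & forall m : nat, (0 < m < n)%N -> x ^+ m <> 1].

(* The congruence on the free monoid of words generated by [(st)^o(st) ~ 1],
   over the pairs with [o(st)] finite.  As [o(ss) = 1] gives [ss ~ 1], each
   letter is its own inverse modulo the congruence, so the quotient is the group
   presented by these relations. *)
Inductive coxeter_cong (W : groupType) (S : finType) (gen : S -> W) :
    seq S -> seq S -> Prop :=
| coxeter_cong_rel s t n : has_order (gen s * gen t) n ->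
    coxeter_cong gen (flatten (nseq n [:: s; t])) [::]
| coxeter_cong_refl u : coxeter_cong gen u u
| coxeter_cong_sym u v : coxeter_cong gen u v -> coxeter_cong gen v u
| coxeter_cong_trans u v w :
    coxeter_cong gen u v -> coxeter_cong gen v w -> coxeter_cong gen u w
| coxeter_cong_cat u u' v v' : coxeter_cong gen u u' -> coxeter_cong gen v v' ->
    coxeter_cong gen (u ++ v) (u' ++ v').

(* The subset [S] of [W] is the range of the injection [cox_gen]. *)
Record coxeterSystem := CoxeterSystem {
  cox_group :> groupType;
  cox_index : finType;
  cox_gen : cox_index -> cox_group;
  cox_gen_inj : injective cox_gen;
  cox_gen_order2 : forall s, has_order (cox_gen s) 2;
  cox_gen_generate : forall w, exists u : seq cox_index,
    \prod_(s <- u) cox_gen s = w;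
  cox_gen_present : forall u v : seq cox_index,
    \prod_(s <- u) cox_gen s = \prod_(s <- v) cox_gen s ->
    coxeter_cong cox_gen u v
}.

Local Notation gen := (@cox_gen _).

Section CoxeterTheory.

Variable W : coxeterSystem.
Local Notation S := (cox_index W).
Implicit Types (w : W) (J : {set S}).

Lemma cox_word_length w :
  exists n, [exists u : n.-tuple S, \prod_(s <- u) gen s == w].
Proof.
have [u def_w] := cox_gen_generate w.
by exists (size u); apply/existsP; exists (in_tuple u); apply/eqP.
Qed.

Definition cox_length w : nat := ex_minn (cox_word_length w).

(* The subgroup generated by [J]; inverses of letters are not needed, since the
   generators are involutions. *)
Definition parabolic J : set W :=
  [set w | exists2 u : seq S, {subset u <= J} & \prod_(s <- u) gen s = w].

Definition spherical J : Prop := finite_set (parabolic J).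

(* Meaningful for spherical [J] only. *)
Definition longest J : W :=
  xget 1 [set r | parabolic J r /\
    forall w, parabolic J w -> (cox_length w <= cox_length r)%N].

Definition two_spherical : Prop :=
  forall s t : S, exists n, has_order (gen s * gen t) n.

End CoxeterTheory.

(** * Buildings *)

Record is_building (W : coxeterSystem) (C : Type) (d : C -> C -> W) : Prop :=
  IsBuilding {
  building_nonempty : inhabited C;
  building_eq : forall x y, d x y = 1 <-> x = y;
  building_step : forall x y z (s : cox_index W), d y z = gen s ->
    d x z = d x y \/ d x z = d x y * gen s;
  building_step_up : forall x y z (s : cox_index W), d y z = gen s ->
    cox_length (d x y * gen s) = (cox_length (d x y)).+1 ->
    d x z = d x y * gen s;
  building_ex : forall x y (s : cox_index W),
    exists z, d y z = gen s /\ d x z = d x y * gen s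
}.

Section Building.

Variables (W : coxeterSystem) (C : Type) (d : C -> C -> W).
Local Notation S := (cox_index W).
Implicit Types (J : {set S}) (R P Q X : set C).

Definition residue J (x : C) : set C := [set y | parabolic J (d x y)].

Definition is_residue J R : Prop := exists x, R = residue J x.

Definition is_panel P : Prop := exists J, #|J| = 1%N /\ is_residue J P.

Definition panel (s : S) (x : C) : set C := residue [set s]%SET x.

Definition thick_building : Prop := forall P, is_panel P ->
  exists x y z, [/\ P x, P y & P z] /\ [/\ x <> y, y <> z & x <> z].

(* [R1] and [R2] are opposite in the spherical residue [R] of type [J]. *)
Definition opposite_in J R R1 R2 : Prop :=
  [/\ spherical J, is_residue J R, R1 `<=` R, R2 `<=` R &
  exists J1 J2, [/\ is_residue J1 R1, is_residue J2 R2,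
    exists x y, [/\ R1 x, R2 y & d x y = longest J] &
    [set gen s | s in [set` J1]] =
    [set longest J * gen s * longest J | s in [set` J2]]]].

(* [P] and [Q] are adjacent panels and [R] is the residue [R(P,Q)], of type [J]. *)
Definition adjacent_in J R P Q : Prop :=
  [/\ is_panel P, is_panel Q, #|J| = 2%N & opposite_in J R P Q].

Definition is_proj R (x z : C) : Prop :=
  R z /\ forall y, R y ->
    cox_length (d x y) = (cox_length (d x z) + cox_length (d z y))%N.

Definition proj_set R X : set C := [set z | exists2 x, X x & is_proj R x z].

(* [Ps] is the sequence (P_0, ..., P_k) and [Js] its type (J_1, ..., J_k); the
   type is 0-indexed, so that the residue R(P_i, P_{i+1}) has type [nth _ Js i].
   That residue is unique, hence it may be quantified existentially. *)
Definition compatible_path (Ps : seq (set C)) (Js : seq {set S}) : Prop :=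
  [/\ size Ps = (size Js).+1,
      forall i, (i < size Ps)%N -> is_panel (nth set0 Ps i) &
      forall i, (i < size Js)%N -> exists R,
        adjacent_in (nth finset.set0 Js i) R (nth set0 Ps i) (nth set0 Ps i.+1)
        /\ proj_set R (nth set0 Ps 0) = nth set0 Ps i].

End Building.

(* Any two elements of [V] are joined by a sequence of elements of [V] whose
   consecutive terms are related by [E]. *)
Definition connected_on (T : Type) (V : set T) (E : T -> T -> Prop) : Prop :=
  forall x y, V x -> V y -> exists (k : nat) (p : nat -> T),
    [/\ p 0%N = x, p k = y, forall i, (i <= k)%N -> V (p i) &
        forall i, (i < k)%N -> E (p i) (p i.+1)].

(** * Twin buildings *)

(* The sign is a boolean, so that [C (~~ e)] is the half opposite to [C e]; by
   conversion [~~ true = false] and [~~ false = true], which types the symmetry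
   axiom. *)
Record twinBuilding (W : coxeterSystem) := TwinBuilding {
  tw_chamber : bool -> Type;
  tw_dist : forall e, tw_chamber e -> tw_chamber e -> W;
  tw_codist : forall e, tw_chamber e -> tw_chamber (~~ e) -> W;
  tw_building : forall e, is_building (@tw_dist e);
  tw_codist_sym : forall (x : tw_chamber true) (y : tw_chamber false),
    @tw_codist false y x = (@tw_codist true x y)^-1;
  tw_codist_step : forall e (x : tw_chamber e) (y z : tw_chamber (~~ e))
      (s : cox_index W),
    tw_dist y z = gen s ->
    (* [l(ws) = l(w) - 1], written additively because the lengths are naturals *)
    (cox_length (tw_codist x y * gen s)).+1 = cox_length (tw_codist x y) ->
    tw_codist x z = tw_codist x y * gen s;
  tw_codist_ex : forall e (x : tw_chamber e) (y : tw_chamber (~~ e))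
      (s : cox_index W),
    exists z, tw_dist y z = gen s /\ tw_codist x z = tw_codist x y * gen s
}.

Section TwinBuilding.

Variables (W : coxeterSystem) (D : twinBuilding W).
Local Notation S := (cox_index W).
Local Notation C := (tw_chamber D).
Local Notation d := (@tw_dist W D _).
Local Notation codist := (@tw_codist W D _).

Definition thick : Prop := forall e, thick_building (@tw_dist W D e).

Definition opp_chambers e (c : C e) : set (C (~~ e)) :=
  [set x | codist c x = 1].

Definition opposite_residues e (R : set (C e)) (R' : set (C (~~ e))) : Prop :=
  exists J, [/\ is_residue d J R, is_residue d J R' &
    exists x y, [/\ R x, R' y & codist x y = 1]].

Definition condition_co : Prop := forall e (c : C e),
  connected_on (opp_chambers c)
    (fun x y => exists s : S, parabolic [set s]%SET (d x y)).

(* [l(x,y) = l(x,z) - l(z,y)], written additively. *)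
Definition is_coproj e (R : set (C (~~ e))) (x : C e) (z : C (~~ e)) : Prop :=
  R z /\ forall y, R y ->
    (cox_length (codist x y) + cox_length (d z y))%N = cox_length (codist x z).

Definition coproj_set e (R : set (C (~~ e))) (X : set (C e)) :
    set (C (~~ e)) :=
  [set z | exists2 x, X x & is_coproj R x z].

Definition panel_compatible_path e (P : set (C e))
    (Ps : seq (set (C (~~ e)))) (Js : seq {set S}) : Prop :=
  [/\ compatible_path d Ps Js,
      opposite_residues P (nth set0 Ps 0) &
      forall i, (i < size Js)%N -> exists R,
        adjacent_in d (nth finset.set0 Js i) R
          (nth set0 Ps i) (nth set0 Ps i.+1)
        /\ coproj_set R P = nth set0 Ps i.+1].

Definition Gamma_vertex (s : S) e (c : C e) : set (set (C (~~ e))) :=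
  [set Q | is_panel d Q /\ opposite_residues (panel d s c) Q].

(* The two paths have the same type [Js], hence also the same length. *)
Definition Gamma_edge (s : S) e (c : C e) (Q1 Q2 : set (C (~~ e))) : Prop :=
  exists (T : set (C (~~ e))) (Ps1 Ps2 : seq (set (C (~~ e))))
         (Js : seq {set S}),
    [/\ is_panel d T,
        [/\ panel_compatible_path (panel d s c) Ps1 Js,
            nth set0 Ps1 0 = Q1 & nth set0 Ps1 (size Js) = T] &
        [/\ panel_compatible_path (panel d s c) Ps2 Js,
            nth set0 Ps2 0 = Q2 & nth set0 Ps2 (size Js) = T]].

Definition wall_connected : Prop := forall e (c : C e) (s : S),
  connected_on (Gamma_vertex s c) (Gamma_edge s c).

End TwinBuilding.

(* Main.v *)
Require Import Defs.
From mathcomp Require Import all_boot.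
From mathcomp Require Import boolp classical_sets functions cardinality.

(* Let y, y' be t-adjacent chambers opposite c, with t <> s, and let R be their
   {s,t}-residue, which is spherical. The projection T to R of the s-panel of c
   is opposite in R to both s-panels of y and y', so these panels have
   compatible paths of length 1 and type {s,t} to T and are joined by an edge.
   Every panel opposite to the s-panel of c contains a chamber opposite to c,
   so Condition (co) connects the graph. The metric properties of R come from
   the exchange condition, obtained from the presentation of W by counting
   modulo 2 the occurrences of a reflection along a word. *)

Set Implicit Arguments.
Unset Strict Implicit.
Unset Printing Implicit Defensive.

Local Open Scope classical_set_scope.
Local Open Scope group_scope.

(** * Words and length in a Coxeter group *)

Section Coxeter.

Variable W : coxeterSystem.
Local Notation S := (cox_index W).
Local Notation gen := (@cox_gen W).
Local Notation len := (@cox_length W).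
Implicit Types (s t : S) (u v : seq S) (w x : W) (J : {set S}).

Definition word_prod u : W := \prod_(s <- u) gen s.

Lemma word_prod_nil : word_prod [::] = 1.
Proof. by rewrite /word_prod big_nil. Qed.

Lemma word_prod_cons s u : word_prod (s :: u) = gen s * word_prod u.
Proof. by rewrite /word_prod big_cons. Qed.

Lemma word_prod_cat u v : word_prod (u ++ v) = word_prod u * word_prod v.
Proof. by rewrite /word_prod big_cat. Qed.

Lemma word_prod_rcons u s : word_prod (rcons u s) = word_prod u * gen s.
Proof.
by rewrite -cats1 word_prod_cat word_prod_cons word_prod_nil mulg1.
Qed.

Lemma gen_mul s : gen s * gen s = 1.
Proof. by have [_ h _] := cox_gen_order2 s; rewrite -[RHS]h expg2. Qed.

Lemma gen_inv s : (gen s)^-1 = gen s.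
Proof. by apply: (mulgI (gen s)); rewrite mulgV gen_mul. Qed.

Lemma gen_neq1 s : gen s <> 1.
Proof. by have [_ _ h] := cox_gen_order2 s; have := h 1%N isT. Qed.

Lemma gen_mulK s w : gen s * (gen s * w) = w.
Proof. by rewrite mulgA gen_mul mul1g. Qed.

Lemma mulg_genK w s : w * gen s * gen s = w.
Proof. by rewrite -mulgA gen_mul mulg1. Qed.

Lemma word_prod_rev u : word_prod (rev u) = (word_prod u)^-1.
Proof.
elim: u => [|s u IH]; first by rewrite word_prod_nil invg1.
by rewrite rev_cons word_prod_rcons IH word_prod_cons invgM gen_inv.
Qed.

Lemma len_word_prod u : (len (word_prod u) <= size u)%N.
Proof.
rewrite /cox_length; case: ex_minnP => n _; apply.
by apply/existsP; exists (in_tuple u).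
Qed.

Lemma reduced_word w : exists2 u, word_prod u = w & size u = len w.
Proof.
rewrite /cox_length; case: ex_minnP => n /existsP[u /eqP def_w] _.
by exists u => //; rewrite size_tuple.
Qed.

Lemma len1 : len 1 = 0%N.
Proof. by have := len_word_prod [::]; rewrite word_prod_nil leqn0 => /eqP. Qed.

Lemma len_eq0 w : len w = 0%N -> w = 1.
Proof.
have [u <- <-] := reduced_word w.
by case: u => // _; rewrite word_prod_nil.
Qed.

Lemma len_mul w x : (len (w * x) <= len w + len x)%N.
Proof.
have [[u <- <-] [v <- <-]] := (reduced_word w, reduced_word x).
by rewrite -word_prod_cat -size_cat len_word_prod.
Qed.

Lemma len_inv w : len w^-1 = len w.
Proof.
have le_inv x : (len x^-1 <= len x)%N.
  by have [u <- <-] := reduced_word x; rewrite -word_prod_rev -size_rev len_word_prod.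
by apply/eqP; rewrite eqn_leq le_inv -{1}[w]invgK le_inv.
Qed.

Lemma len_gen s : len (gen s) = 1%N.
Proof.
have := len_word_prod [:: s]; rewrite word_prod_cons word_prod_nil mulg1 /=.
case E: (len (gen s)) => [|[|n]] // _.
by case: (@gen_neq1 s); apply: len_eq0.
Qed.

Lemma len_reduced_prefix u v : len (word_prod (u ++ v)) = size (u ++ v) ->
  len (word_prod u) = size u.
Proof.
rewrite word_prod_cat size_cat => h.
apply/eqP; rewrite eqn_leq len_word_prod -(leq_add2r (size v)) -h.
by rewrite (leq_trans (len_mul _ _)) // leq_add2l len_word_prod.
Qed.

(** The relators have even length [2n], so the parity of the length of a word is invariant under the
    Coxeter congruence. The presentation makes a reduced word of [gen s * w] congruent to [s]
    followed by one of [w]. *)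
Lemma odd_len_gen_mul s w : odd (len (gen s * w)) = ~~ odd (len w).
Proof.
have odd_cong u v : coxeter_cong gen u v -> odd (size u) = odd (size v).
  elim=> {u v} [s0 t n _|//|//|u v u' _ -> //|u u' v v' _ h _ h'].
    by elim: n => //= n ->.
  by rewrite !size_cat !oddD h h'.
have [[u def_u su] [v def_v sv]] := (reduced_word w, reduced_word (gen s * w)).
rewrite -su -sv -[~~ _]/(odd (size (s :: u))); apply: odd_cong.
by apply: cox_gen_present; rewrite -!/(word_prod _) word_prod_cons def_u.
Qed.

(** * Reflections along a word and the exchange condition *)

(* For a word [s_1 ... s_k], the reflections
   [s_1 ... s_(i-1) s_i s_(i-1) ... s_1]. *)
Fixpoint refls u : seq W :=
  if u is s :: u' then gen s :: [seq gen s * x * gen s | x <- refls u']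
  else [::].

Lemma refls_cat u v : refls (u ++ v) =
  refls u ++ [seq word_prod u * x * (word_prod u)^-1 | x <- refls v].
Proof.
elim: u => [|s u IH] /=.
  rewrite word_prod_nil invg1 -[LHS]map_id.
  by apply: eq_map => x; rewrite mul1g mulg1.
rewrite IH map_cat -map_comp; congr (_ :: _ ++ _).
by apply: eq_map => x /=; rewrite word_prod_cons invgM gen_inv !mulgA.
Qed.

Lemma count_conj w x (l : seq W) :
  count_mem x [seq w * y * w^-1 | y <- l] = count_mem (w^-1 * x * w) l.
Proof.
rewrite count_map; apply: eq_count => y /=.
apply/eqP/eqP => [<-|->]; first by rewrite !mulgA mulVg mul1g mulgVK.
by rewrite !mulgA mulgV mul1g mulgK.
Qed.

Lemma refls_dihedral s t n : refls (flatten (nseq n [:: s; t])) =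
  [seq (gen s * gen t) ^+ i * gen s | i <- iota 0 (n + n)].
Proof.
elim: n => // n IH.
rewrite addSn addnS /= IH -/(flatten _) expg0 mul1g expg1.
congr [:: _, _ & _]; rewrite (iotaDl 2 0) -!map_comp.
apply: eq_map => i /=.
by rewrite expgS expgSr !mulgA.
Qed.

Lemma coxeter_cong_word_prod u v : coxeter_cong gen u v ->
  word_prod u = word_prod v.
Proof.
elim=> {u v} [s t n [_ h _]|//|//|u v u' _ -> //|u u' v v' _ h _ h'].
  rewrite word_prod_nil -h; elim: n {h} => [|n IH] /=; first exact: word_prod_nil.
  by rewrite !word_prod_cons IH expgS mulgA.
by rewrite !word_prod_cat h h'.
Qed.

(** Along a relator of [2n] letters the reflections are [(gen s * gen t) ^+ i * gen s] for [i < 2n].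
    They repeat with period [n], so each occurs an even number of times. For concatenations,
    congruent prefixes conjugate by the same element. *)
Lemma odd_count_refls u v x : word_prod u = word_prod v ->
  odd (count_mem x (refls u)) = odd (count_mem x (refls v)).
Proof.
move/cox_gen_present => cuv.
elim: cuv x => {u v} [s t n [_ h _]|//|u v _ IH|u v u' _ IH _ IH'|u u' v v' huv IH _ IH'] x.
- rewrite refls_dihedral iotaD map_cat count_cat.
  rewrite add0n -{2}[n]addn0 iotaDl -map_comp.
  rewrite (@eq_map _ _ _ (fun i => (gen s * gen t) ^+ i * gen s)).
    by rewrite addnn odd_double.
  by move=> i /=; rewrite expgnDr h mul1g.
- by rewrite IH.
- by rewrite IH.
- rewrite !refls_cat !count_cat !oddD !count_conj IH IH'.
  by rewrite (coxeter_cong_word_prod huv).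
Qed.

(** Left multiplication by the reflection at position [i] deletes letter [i] from the word; stating
    this on prefixes keeps the rest of the word out of the way. *)
Lemma mem_refls u x : x \in refls u ->
  exists2 i, (i < size u)%N & x * word_prod (take i u) = word_prod (take i.+1 u).
Proof.
elim: u x => // s u IH x; rewrite inE => /predU1P[->|/mapP[y /IH[i lt_i h] ->]].
  by exists 0%N => //=; rewrite take0 word_prod_nil word_prod_cons word_prod_nil.
exists i.+1 => //; rewrite [take i.+2 _]/= [take i.+1 _]/= !word_prod_cons -h.
by rewrite -!mulgA gen_mulK.
Qed.

(* With [w] the shorter of [s u] and [u], the reflection [gen s] occurs once along
   the word [s] followed by a reduced word of [w], hence an odd number of times
   along [u]. *)
Lemma exchange s u :
    len (gen s * word_prod u) <> (len (word_prod u)).+1 ->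
  exists2 i, (i < size u)%N &
    gen s * word_prod (take i u) = word_prod (take i.+1 u).
Proof.
move=> not_up; apply: mem_refls; set w := gen s * word_prod u.
have def_u : word_prod u = gen s * w by rewrite gen_mulK.
have [v def_v size_v] := reduced_word w.
(* The two lengths differ by at most 1 and have different parities. *)
have len_up : len (word_prod u) = (len w).+1.
  have le1 : (len (word_prod u) <= (len w).+1)%N.
    by rewrite def_u (leq_trans (len_mul _ _)) // len_gen.
  have le2 : (len w <= (len (word_prod u)).+1)%N.
    by rewrite (leq_trans (len_mul _ _)) // len_gen.
  have := odd_len_gen_mul s (word_prod u); rewrite -/w.
  move: le1 le2 not_up; rewrite -/w.
  case: (ltngtP (len w) (len (word_prod u))) => [lt h _ _ _|lt _ h []|-> _ _ _].
  - by apply/eqP; rewrite eqn_leq h lt.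
  - by apply/eqP; rewrite eqn_leq h lt.
  - by case: odd.
(* Otherwise [v] with one letter deleted would spell [word_prod u], which is longer than [v]. *)
have s_notin : gen s \notin refls v.
  apply/negP => /mem_refls[i lt_i def_i].
  suff : (len (word_prod u) < size v)%N by rewrite len_up size_v ltnNge leqnSn.
  rewrite def_u -def_v -{1}(cat_take_drop i v) (drop_nth s lt_i) word_prod_cat.
  rewrite mulgA def_i (take_nth s lt_i) word_prod_rcons word_prod_cons -mulgA gen_mulK.
  rewrite -word_prod_cat (leq_ltn_trans (len_word_prod _)) //.
  by rewrite size_cat size_takel ?(ltnW lt_i) // size_drop -{2}(subnKC lt_i) addSn.
have def_sv : word_prod u = word_prod (s :: v) by rewrite word_prod_cons def_v.
(* Conjugation by [gen s] fixes [gen s], so the tail of [refls (s :: v)] contains it as often as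
   [refls v] does, that is, never. *)
have := odd_count_refls (gen s) def_sv; rewrite /= eqxx.
rewrite -[X in map _ X]map_id.
have -> : [seq gen s * x * gen s | x <- [seq x | x <- refls v]] =
          [seq gen s * x * (gen s)^-1 | x <- refls v].
  by rewrite map_id; apply: eq_map => x; rewrite gen_inv.
rewrite count_conj gen_inv gen_mul mul1g (count_memPn s_notin) /=.
by case: (boolP (gen s \in refls u)) => // /count_memPn ->.
Qed.

(** Parity excludes equal lengths; it is known for left multiplication, hence the passage to
    [w^-1]. *)
Lemma len_mul_gen w s :
  len (w * gen s) = (len w).+1 \/ (len (w * gen s)).+1 = len w.
Proof.
have le1 : (len (w * gen s) <= (len w).+1)%N.
  by rewrite (leq_trans (len_mul _ _)) // len_gen addn1.
have le2 : (len w <= (len (w * gen s)).+1)%N.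
  by rewrite -{1}(mulg_genK w s) (leq_trans (len_mul _ _)) // len_gen addn1.
have := odd_len_gen_mul s w^-1.
rewrite -(len_inv (_ * _)) invgM invgK gen_inv len_inv.
case: (ltngtP (len (w * gen s)) (len w)) => [lt _|lt _|->].
- by right; apply/eqP; rewrite eqn_leq lt le2.
- by left; apply/eqP; rewrite eqn_leq lt le1.
- by case: odd.
Qed.

(** * Parabolic subgroups *)

Lemma parabolic1 J : parabolic J (1 : W).
Proof. by exists [::] => //; exact: word_prod_nil. Qed.

Lemma parabolicM J w x : parabolic J w -> parabolic J x -> parabolic J (w * x).
Proof.
move=> [u uJ <-] [v vJ <-]; exists (u ++ v); last exact: word_prod_cat.
by move=> s; rewrite mem_cat => /orP[/uJ|/vJ].
Qed.

Lemma parabolic_gen J s : s \in J -> parabolic J (gen s).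
Proof.
move=> sJ; exists [:: s]; first by move=> t; rewrite inE => /eqP->.
by rewrite -/(word_prod _) word_prod_cons word_prod_nil mulg1.
Qed.

Lemma parabolicV J w : parabolic J w -> parabolic J w^-1.
Proof.
move=> [u uJ <-]; exists (rev u); last exact: word_prod_rev.
by move=> s; rewrite mem_rev => /uJ.
Qed.

(** Letters are appended on the right, as in the axioms of buildings. *)
Lemma parabolic_ind J (P : W -> Prop) : P 1 ->
    (forall w s, parabolic J w -> s \in J -> P w -> P (w * gen s)) ->
  forall w, parabolic J w -> P w.
Proof.
move=> P1 PM w [u uJ <-]; rewrite -/(word_prod u).
elim/last_ind: u uJ => [|u s IH] uJ; first by rewrite word_prod_nil.
have uJ' : {subset u <= J} by move=> t tu; apply: uJ; rewrite mem_rcons inE tu orbT.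
rewrite word_prod_rcons; apply: PM; [by exists u| |exact: IH].
by apply: uJ; rewrite mem_rcons mem_head.
Qed.

(** When a new first letter does not increase the length, exchange cancels it against a letter of
    the word, and deleting letters never leaves [J]. *)
Lemma parabolic_reduced J w : parabolic J w ->
  exists u, [/\ {subset u <= J}, word_prod u = w & size u = len w].
Proof.
move=> [v vJ <-]; rewrite -/(word_prod v).
elim: v vJ => [|s v IH] vJ; first by exists [::]; rewrite word_prod_nil len1.
have [|u [uJ def_u size_u]] := IH; first by move=> t tv; apply: vJ; rewrite inE tv orbT.
rewrite word_prod_cons -def_u.
have [up|not_up] := pselect (len (gen s * word_prod u) = (len (word_prod u)).+1).
  exists (s :: u); rewrite word_prod_cons up /= size_u def_u; split=> //.
  by move=> t; rewrite inE => /predU1P[->|/uJ //]; apply: vJ; rewrite mem_head.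
have [i lt_i def_i] := exchange not_up.
pose u' := take i u ++ drop i.+1 u.
have def_u' : word_prod u' = gen s * word_prod u.
  rewrite -[in RHS](cat_take_drop i.+1 u) !word_prod_cat -def_i.
  by rewrite -mulgA gen_mulK.
have u'J : {subset u' <= J}.
  by move=> t; rewrite mem_cat => /orP[/mem_take|/mem_drop]; exact: uJ.
exists u'; split=> //; apply/eqP; rewrite eqn_leq -{2}def_u' len_word_prod andbT.
rewrite -ltnS size_cat size_takel ?(ltnW lt_i) // size_drop -addSn subnKC //.
rewrite size_u -def_u -{1}[word_prod u](gen_mulK s).
by rewrite (leq_trans (len_mul _ _)) // len_gen.
Qed.

Lemma parabolic_reduced_ind J (P : W -> Prop) : P 1 ->
    (forall w s, parabolic J w -> s \in J ->
       len (w * gen s) = (len w).+1 -> P w -> P (w * gen s)) ->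
  forall w, parabolic J w -> P w.
Proof.
move=> P1 PM w /parabolic_reduced[u [uJ <-]].
elim/last_ind: u uJ => [|u s IH] uJ size_u; first by rewrite word_prod_nil.
have uJ' : {subset u <= J} by move=> t tu; apply: uJ; rewrite mem_rcons inE tu orbT.
have red_u : size u = len (word_prod u).
  by rewrite (@len_reduced_prefix u [:: s]) // cats1 -size_u.
rewrite word_prod_rcons; apply: PM; [by exists u| | |exact: IH].
  by apply: uJ; rewrite mem_rcons mem_head.
by rewrite -word_prod_rcons -size_u size_rcons red_u.
Qed.

Lemma mem_parabolic_gen J s : parabolic J (gen s) -> s \in J.
Proof.
move=> /parabolic_reduced[[|t [|t' u]] [uJ]]; rewrite len_gen //.
rewrite word_prod_cons word_prod_nil mulg1 => /cox_gen_inj <- _.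
by apply: uJ; rewrite mem_head.
Qed.

Lemma parabolic_set1 s w : parabolic [set s]%SET w <-> w = 1 \/ w = gen s.
Proof.
split=> [|[]->]; last 2 first.
- exact: parabolic1.
- by apply: parabolic_gen; rewrite inE.
elim/parabolic_ind => [|{}w t _]; first by left.
by rewrite inE => /eqP-> [] ->; [right|left]; rewrite ?mul1g ?gen_mul.
Qed.

(** With [x = gen s * gen t], every element is [x ^+ i] or [x ^+ i * gen s] for some [i < n]. *)
Lemma spherical_set2 s t n : has_order (gen s * gen t) n ->
  spherical [set s; t]%SET.
Proof.
move=> [n_gt0 st_n _]; set x := gen s * gen t in st_n.
have x_mod i : x ^+ i = x ^+ (i %% n).
  by rewrite {1}(divn_eq i n) expgnDr mulnC expgnA st_n expg1n mul1g.
apply: (@sub_finite_set _ _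
  ((fun p : 'I_n * bool => x ^+ p.1 * (if p.2 then gen s else 1)) @` setT)); last first.
  exact: finite_image.
have mem_dihedral i b : ((fun p : 'I_n * bool =>
    x ^+ p.1 * (if p.2 then gen s else 1)) @` setT) (x ^+ i * (if b then gen s else 1)).
  exists (Ordinal (ltn_pmod i n_gt0), b) => //=.
  by rewrite -x_mod.
(* This brings right multiplication by [gen t] back to the chosen form. *)
have x_pred : x ^+ n.-1 * gen s = gen t.
  by rewrite -[LHS](mulg_genK _ t) -(mulgA (x ^+ n.-1)) -/x -expgSr prednK // st_n mul1g.
move=> w; elim/parabolic_ind => [|{}w q _ q_st [[i b] _ <-]] /=.
  by have := mem_dihedral 0%N false; rewrite mul1g.
move: q_st; rewrite !inE => /orP[]/eqP->; case: b.
- by rewrite mulg_genK -[x ^+ i]mulg1; apply: (mem_dihedral i false).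
- by rewrite mulg1; apply: (mem_dihedral i true).
- rewrite -mulgA -/x -expgSr -[x ^+ _]mulg1; exact: (mem_dihedral i.+1 false).
- rewrite mulg1 -x_pred mulgA -expgnDr; exact: (mem_dihedral (i + n.-1)%N true).
Qed.

(** * The longest element of a spherical parabolic subgroup *)

Lemma longestP J : spherical J -> parabolic J (longest J) /\
  forall w, parabolic J w -> (len w <= len (longest J))%N.
Proof.
move=> /finite_seqP[l defJ].
pose attained n := `[< exists2 w, parabolic J w & len w = n >].
have ex_n : exists n, attained n.
  by exists 0%N; apply/asboolP; exists 1; [exact: parabolic1 | exact: len1].
have ub_n n : attained n -> (n <= \max_(w <- l) len w)%N.
  move=> /asboolP[w wJ <-]; apply: (@leq_bigmax_seq _ l xpredT len w) => //.
  by move: wJ; rewrite defJ.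
(* An element of maximal length exists, so [xget] does not fall back on its default value 1. *)
rewrite /longest; set A := [set r | _]; apply: (@xgetPex _ 1 A); case: (ex_maxnP ex_n ub_n) => n.
move=> /asboolP[r rJ len_r] max_n; exists r; split=> // w wJ.
by rewrite len_r; apply: max_n; apply/asboolP; exists w.
Qed.

Section Longest.

Variable J : {set S}.
Hypothesis sphJ : spherical J.
Local Notation r := (longest J).

Lemma longest_parabolic : parabolic J r. Proof. by case: (longestP sphJ). Qed.

Lemma longest_max w : parabolic J w -> (len w <= len r)%N.
Proof. by case: (longestP sphJ) => _; apply. Qed.

(** Induction on a reduced word of [w], adding letters in front. If [u] is a prefix of a reduced
    word [u ++ v] of [r], then [gen s * r] is not longer than [r], and exchange deletes a letter of
    [u ++ v]. *)
Lemma len_longest w : parabolic J w -> len r = (len w + len (w^-1 * r))%N.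
Proof.
move=> /parabolic_reduced[u [uJ <-]]; rewrite -/(word_prod u).
elim: u uJ => [|s u IH] uJ size_u; first by rewrite word_prod_nil len1 invg1 mul1g.
have red_u : size u = len (word_prod u).
  have : (size (s :: u) <= 1 + len (word_prod u))%N.
    by rewrite size_u word_prod_cons (leq_trans (len_mul _ _)) // len_gen.
  by move=> h; apply/eqP; rewrite eqn_leq len_word_prod andbT.
have uJ' : {subset u <= J} by move=> t tu; apply: uJ; rewrite inE tu orbT.
have sJ : s \in J by apply: uJ; rewrite mem_head.
have := IH uJ' red_u; set x := _^-1 * r => len_r.
have [v def_v size_v] := reduced_word x.
have def_uv : word_prod (u ++ v) = r by rewrite word_prod_cat def_v mulVKg.
have [|i] := @exchange s (u ++ v).
  rewrite def_uv => up; have : parabolic J (gen s * r).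
    by apply: parabolicM; [exact: parabolic_gen | exact: longest_parabolic].
  by move/longest_max; rewrite up ltnn.
(* The deleted letter is not in [u], because [s :: u] is reduced. Hence it is in [v], and what
   remains of [v] spells [(word_prod (s :: u))^-1 * r]. *)
rewrite size_cat => lt_i; case: (ltnP i (size u)) => [lt_iu|le_ui] def_i.
  exfalso; move: def_i size_u.
  have le_i := ltnW lt_iu.
  rewrite !takel_cat // word_prod_cons -{4}(cat_take_drop i.+1 u) word_prod_cat.
  move=> <-; rewrite mulgA gen_mulK -word_prod_cat /= => h.
  have := len_word_prod (take i u ++ drop i.+1 u); rewrite -h.
  rewrite size_cat size_takel // size_drop leqNgt.
  by rewrite -{2}(subnKC lt_iu) addSn ltnS leqnSn.
apply/eqP; rewrite eqn_leq -{1}[r](mulVKg (word_prod (s :: u))) len_mul /=.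
rewrite -size_u /= len_r -red_u addSnnS leq_add2l.
move: def_i; rewrite !take_cat leq_gtF // ltnNge leqW //= subSn //.
set k := (i - size u)%N => def_k.
have lt_k : (k < size v)%N by rewrite /k ltn_subLR.
rewrite -size_v -(subnKC lt_k) addSn ltnS.
suff -> : (word_prod (s :: u))^-1 * r = word_prod (take k v ++ drop k.+1 v).
  by rewrite (leq_trans (len_word_prod _)) // size_cat size_takel ?(ltnW lt_k) // size_drop.
rewrite word_prod_cons invgM gen_inv -def_uv -{1}(cat_take_drop k.+1 v) catA.
rewrite word_prod_cat -def_k -!mulgA gen_mulK !word_prod_cat !mulgA.
by rewrite mulVg mul1g.
Qed.

(** Taking [w = r^-1] in [len_longest] leaves length 0 for [r * r]. *)
Lemma longestV : r^-1 = r.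
Proof.
have := len_longest (parabolicV longest_parabolic).
rewrite len_inv invgK -[LHS]addn0 => /addnI /esym/len_eq0 h.
by apply: (mulgI r); rewrite mulgV h.
Qed.

Lemma longest_mul : r * r = 1.
Proof. by rewrite -{1}longestV mulVg. Qed.

Lemma len_longest_mul w : parabolic J w -> len r = (len (r * w) + len w)%N.
Proof.
move=> wJ; rewrite (len_longest wJ) addnC; congr (_ + _)%N.
by rewrite -len_inv invgM invgK longestV.
Qed.

(** For [w = r * gen s * r] the product [r * w = gen s * r] is one shorter than [r], so [w] has
    length 1 and is a generator from [J]. *)
Lemma longest_conj s : s \in J ->
  exists2 s', s' \in J & gen s' = r * gen s * r.
Proof.
move=> sJ; set w := r * gen s * r.
have genJ := parabolic_gen sJ.
have wJ : parabolic J w.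
  by do !apply: parabolicM => //; exact: longest_parabolic.
have : len w = 1%N.
  have := len_longest_mul wJ.
  rewrite /w !mulgA longest_mul mul1g (len_longest genJ) gen_inv len_gen addnC.
  by move/addnI.
have [u [uJ <- <-]] := parabolic_reduced wJ.
case: u uJ => [|s' [|]] // uJ _; exists s'; first by apply: uJ; rewrite mem_head.
by rewrite word_prod_cons word_prod_nil mulg1.
Qed.

End Longest.
End Coxeter.

(** * Distances, residues and panels in a building *)

Section Building.

Variables (W : coxeterSystem) (C : Type) (d : C -> C -> W).
Hypothesis dB : is_building d.
Local Notation S := (cox_index W).
Local Notation gen := (@cox_gen W).
Local Notation len := (@cox_length W).
Implicit Types (s t : S) (J : {set S}) (x y z : C) (w : W).

Lemma dist_refl x : d x x = 1.
Proof. by apply/(building_eq dB). Qed.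

Lemma dist_gen_sym x y s : d x y = gen s -> d y x = gen s.
Proof.
move=> xy; have := building_step dB y xy; rewrite dist_refl => -[].
  move=> /esym/(building_eq dB) yx; move: xy; rewrite yx dist_refl => h.
  by case: (@gen_neq1 W s).
by move=> h; rewrite -[LHS](mulg_genK _ s) -h mul1g.
Qed.

Lemma dist_gen_trans x y z s : d x y = gen s -> d x z = gen s ->
  y = z \/ d y z = gen s.
Proof.
move=> /dist_gen_sym yx xz; case: (building_step dB y xz); rewrite yx.
  by right.
by rewrite gen_mul => /(building_eq dB); left.
Qed.

Lemma dist_mul_gen_ex x y w s : d x y = w * gen s ->
  exists2 y', d x y' = w & d y' y = gen s.
Proof.
move=> xy; have [y' [yy' xy']] := building_ex dB x y s.
by exists y'; [rewrite xy' xy mulg_genK | exact: dist_gen_sym].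
Qed.

Lemma dist_parabolic_trans J x y z :
  parabolic J (d x y) -> parabolic J (d y z) -> parabolic J (d x z).
Proof.
move=> xyJ yzJ; move def_w : (d y z) yzJ => w wJ; move: w wJ z def_w.
apply: parabolic_ind => [z /(building_eq dB) <- //|w s wJ sJ IH z].
move=> /dist_mul_gen_ex[z' yz' z'z]; have xz'J := IH _ yz'.
case: (building_step dB x z'z) => -> //.
by apply: parabolicM => //; exact: parabolic_gen.
Qed.

(** In [walk], the end of a gallery goes back from [y0] to [x0] along the reversed word [u], while
    its distance from [y1] is spelled by growing prefixes of the reduced word [v ++ rev u]. Hence
    [building_step_up] applies at each step. *)
Lemma dist_sym x y : d y x = (d x y)^-1.
Proof.
have walk u v x0 y0 : len (word_prod (v ++ rev u)) = size (v ++ rev u) ->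
    d x0 y0 = word_prod u ->
    forall y1, d y1 y0 = word_prod v -> d y1 x0 = word_prod (v ++ rev u).
  elim/last_ind: u v y0 => [|u s IH] v y0 red_v.
    by rewrite word_prod_nil cats0 => /(building_eq dB) -> y1.
  move: red_v; rewrite rev_rcons -cat_rcons => red_v.
  rewrite word_prod_rcons => /dist_mul_gen_ex[y' xy' /dist_gen_sym yy'] y1 y1y0.
  apply: (IH (rcons v s) y') => //; rewrite word_prod_rcons -y1y0.
  apply: building_step_up yy' _ => //; rewrite y1y0 -word_prod_rcons.
  have red_vs := len_reduced_prefix red_v; rewrite red_vs size_rcons; congr _.+1.
  by rewrite (@len_reduced_prefix _ v [:: s]) // cats1.
have [u def_u size_u] := reduced_word (d x y).
have := walk u [::] x y; rewrite /= word_prod_rev def_u; apply => //.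
  by rewrite len_inv size_rev size_u.
by rewrite dist_refl word_prod_nil.
Qed.

Lemma residue_refl J x : residue d J x x.
Proof. by rewrite /residue /= dist_refl; exact: parabolic1. Qed.

Lemma residue_eq J x y : residue d J x y -> residue d J y = residue d J x.
Proof.
rewrite /residue /= => xy; apply/seteqP; split=> z /=.
  exact: dist_parabolic_trans.
by apply: dist_parabolic_trans; rewrite dist_sym; exact: parabolicV.
Qed.

Lemma is_residue_eq J R x : is_residue d J R -> R x -> R = residue d J x.
Proof. by move=> [y ->] /residue_eq. Qed.

Lemma panelP s x y : panel d s x y <-> x = y \/ d x y = gen s.
Proof.
rewrite /panel /residue /= parabolic_set1; split=> -[h|h]; last first.
- by right.
- by left; rewrite h dist_refl.
- by right.
- by left; apply/(building_eq dB).
Qed.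

Lemma is_panel_panel s x : is_panel d (panel d s x).
Proof. by exists [set s]%SET; rewrite cards1; split=> //; exists x. Qed.

Lemma panel_sub_residue J s x : s \in J -> panel d s x `<=` residue d J x.
Proof.
move=> sJ y /panelP[<-|xy]; first exact: residue_refl.
by rewrite /residue /= xy; exact: parabolic_gen.
Qed.

(** Identifies the existentially quantified type in [opposite_residues] when one of the residues is
    a panel. *)
Lemma residue_panel_type J s x : is_residue d J (panel d s x) -> J = [set s]%SET.
Proof.
move=> /is_residue_eq /(_ (@residue_refl _ x)) def_J.
apply/setP => t; rewrite inE; apply/idP/eqP => [tJ|->].
  have [y [xy _]] := building_ex dB x x t.
  have : residue d J x y by rewrite /residue /= xy; exact: parabolic_gen.
  rewrite -def_J => /panelP[yx|].
    by case: (@gen_neq1 W t); rewrite -xy yx dist_refl.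
  by rewrite xy => /cox_gen_inj.
have [y [xy _]] := building_ex dB x x s.
have : panel d s x y by apply/panelP; right.
by rewrite def_J /residue /= xy => /mem_parabolic_gen.
Qed.

(** Since [P_0] lies in the first residue of a path, this gives the compatibility of paths of length
    1. *)
Lemma proj_set_id R X : X `<=` R -> proj_set d R X = X.
Proof.
move=> XR; apply/seteqP; split=> [z [x Xx [_ /(_ x (XR x Xx))]]|x Xx].
  rewrite dist_refl len1 => /esym/eqP; rewrite addn_eq0 => /andP[/eqP].
  by move=> /len_eq0 /(building_eq dB) <-.
by exists x => //; split=> [|y _]; [exact: XR | rewrite dist_refl len1].
Qed.

End Building.

(** * Codistance in a twin building *)

Section TwinBuilding.

Variables (W : coxeterSystem) (D : twinBuilding W).
Local Notation S := (cox_index W).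
Local Notation gen := (@cox_gen W).
Local Notation len := (@cox_length W).
Local Notation C := (tw_chamber D).
Local Notation d := (@tw_dist W D _).
Local Notation codist := (@tw_codist W D _).
Let dB e : is_building (@tw_dist W D e) := @tw_building W D e.

(** The axiom covers only descending steps. In the ascending case one chamber [z'] of the panel
    attains the longer codistance, and every other chamber of the panel is a descending step away
    from [z']. *)
Lemma codist_adjacent e (x : C e) (y z : C (~~ e)) s : d y z = gen s ->
  codist x z = codist x y \/ codist x z = codist x y * gen s.
Proof.
move=> yz; case: (len_mul_gen (codist x y) s) => [up|down]; last first.
  by right; apply: tw_codist_step yz down.
have [z' [yz' xz']] := tw_codist_ex x y s.
case: (dist_gen_trans (dB _) yz' yz) => [<-|z'z]; [by right | left].
have := tw_codist_step (x := x) z'z; rewrite xz' mulg_genK; apply.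
by rewrite up.
Qed.

(** Inversion swaps the two arguments; the cases on [e] arise because the symmetry axiom is stated
    for one order of the signs. *)
Lemma codist_adjacentl e (c p : C e) (x : C (~~ e)) s : d c p = gen s ->
  codist p x = codist c x \/ codist p x = gen s * codist c x.
Proof.
case: e c p x => /= c p x cp.
  have := @codist_adjacent false x c p s cp; rewrite !tw_codist_sym.
  case=> [/invg_inj|h]; [by left | right].
  by apply: invg_inj; rewrite h invgM gen_inv.
rewrite !tw_codist_sym; case: (@codist_adjacent true x c p s cp) => ->.
  by left.
by right; rewrite invgM gen_inv.
Qed.

Lemma codist_exl e (c : C e) (x : C (~~ e)) s :
  exists p, d c p = gen s /\ codist p x = gen s * codist c x.
Proof.
case: e c x => /= c x.
  have [p [cp]] := @tw_codist_ex W D false x c s; rewrite !tw_codist_sym => h.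
  by exists p; split=> //; apply: invg_inj; rewrite h invgM gen_inv.
have [p [cp h]] := @tw_codist_ex W D true x c s.
by exists p; split=> //; rewrite !tw_codist_sym h invgM gen_inv.
Qed.

Lemma codist_parabolic_ex e (c : C e) (y : C (~~ e)) J w : parabolic J w ->
  exists2 z, residue d J y z & codist c z = codist c y * w.
Proof.
move: w; apply: parabolic_ind => [|w s _ sJ [z yz cz]].
  by exists y; [exact: residue_refl (dB _) _ _ | rewrite mulg1].
have [z' [zz' cz']] := tw_codist_ex c z s; exists z'; last by rewrite cz' cz mulgA.
rewrite /residue /=; apply: (dist_parabolic_trans (dB _) yz).
by rewrite zz'; exact: parabolic_gen.
Qed.

(** * Projections between the halves, onto spherical residues *)

Section SphericalResidue.

Variables (e : bool) (J : {set S}).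
Hypothesis sphJ : spherical J.
Local Notation r := (longest J).
Implicit Types (c p : C e) (x y z : C (~~ e)).

(** Along a reduced word of [d z x] the codistance, starting from the longest element, descends at
    every step. *)
Lemma codist_longest c z x : codist c z = r -> residue d J z x ->
  codist c x = r * d z x.
Proof.
move=> cz; rewrite /residue /=; move def_w : (d z x) => w wJ; move: w wJ x def_w.
apply: parabolic_reduced_ind => [x /(building_eq (dB _)) <-|]; first by rewrite mulg1.
move=> w s wJ sJ up IH x /(dist_mul_gen_ex (dB _))[x' /IH cx' x'x].
rewrite mulgA -cx'; apply: tw_codist_step x'x _; rewrite cx' -mulgA.
apply: (@addIn (len w)); rewrite addSnnS -up -!len_longest_mul //.
by apply: parabolicM => //; exact: parabolic_gen.
Qed.

Lemma is_coproj_longest c z : codist c z = r -> is_coproj (residue d J z) c z.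
Proof.
move=> cz; split=> [|x zx]; first exact: residue_refl (dB _) _ _.
by rewrite (codist_longest cz zx) cz -len_longest_mul.
Qed.

(** Substituting one defining equation into the other forces [len (d z z') = 0]. *)
Lemma is_coproj_inj R c z z' : is_coproj R c z -> is_coproj R c z' -> z = z'.
Proof.
move=> [Rz hz] [Rz' hz']; apply/(building_eq (dB _)); apply: len_eq0.
have := hz _ Rz'; rewrite -(hz' _ Rz) -addnA -[RHS]addn0 => /addnI/eqP.
by rewrite addn_eq0 => /andP[_ /eqP].
Qed.

(** Each [p] in the panel of [c] projects to a chamber at codistance [r] from [p]. Comparing its
    codistances from [c] and [p] puts it at distance 1 or [r * gen s * r] from [z]. *)
Lemma coproj_panel c z s s' : s \in J -> s' \in J -> gen s' = r * gen s * r ->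
  codist c z = r -> coproj_set (residue d J z) (panel d s c) = panel d s' z.
Proof.
move=> sJ s'J def_s' cz; set R := residue d J z.
have rs' : r * gen s' = gen s * r by rewrite def_s' !mulgA longest_mul // mul1g.
apply/seteqP; split=> z'.
  move=> [p /(panelP (dB _)) cp p_z']; case: cp => [def_p|cp].
    rewrite -def_p in p_z'; rewrite (is_coproj_inj p_z' (is_coproj_longest cz)).
    exact: residue_refl (dB _) _ _.
  have pzJ : parabolic J (codist p z).
    case: (codist_adjacentl z cp) => ->; rewrite cz; last apply: parabolicM.
    - exact: longest_parabolic.
    - exact: parabolic_gen.
    - exact: longest_parabolic.
  (* The factor [(codist p z)^-1 * r] is chosen so that [codist p z1 = r]. *)
  have [z1 zz1] := codist_parabolic_ex p z
    (parabolicM (parabolicV pzJ) (longest_parabolic sphJ)).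
  rewrite mulVKg => pz1; have := is_coproj_longest pz1.
  rewrite (residue_eq (dB _) zz1) => /(is_coproj_inj p_z') ->.
  apply/(panelP (dB _)); have cz1 := codist_longest cz zz1.
  case: (codist_adjacentl z1 cp); rewrite pz1 cz1 => h.
    left; apply/(building_eq (dB _)); apply: (mulgI r).
    by rewrite -h mulg1.
  by right; apply: (mulgI r); rewrite rs' {2}h gen_mulK.
move=> /(panelP (dB _))[<-|zz'].
  exists c; [exact: residue_refl (dB _) _ _ | exact: is_coproj_longest].
(* Conversely [codist c z' = r * gen s' = gen s * r], so some [p] that is [s]-adjacent to [c] is at
   codistance [r] from [z']. *)
have Rz' : R z' by rewrite /R /residue /= zz'; exact: parabolic_gen.
have [p [cp]] := codist_exl c z' s.
rewrite (codist_longest cz Rz') zz' rs' gen_mulK => /is_coproj_longest.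
rewrite (residue_eq (dB _) Rz') => pz'; exists p => //.
by apply/(panelP (dB _)); right.
Qed.

End SphericalResidue.

(** * Vertices and edges of the graph *)

(** Both paths have length 0, with [T] equal to [Q]. *)
Lemma Gamma_edge_refl e (c : C e) s Q : Gamma_vertex s c Q -> Gamma_edge s c Q Q.
Proof.
move=> [Q_panel Q_opp]; exists Q, [:: Q], [:: Q], [::].
suff : panel_compatible_path (panel d s c) [:: Q] [::] by [].
by split=> //; split=> // -[].
Qed.

Lemma Gamma_vertex_panel e (c : C e) s y : opp_chambers c y ->
  Gamma_vertex s c (panel d s y).
Proof.
move=> cy; split; first exact: is_panel_panel.
exists [set s]%SET; split; [by exists c | by exists y |].
by exists c, y; split=> //; exact: residue_refl (dB _) _ _.
Qed.

(** The opposite pair may involve another chamber of the panel of [c]; then [q] has codistance 1 or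
    [gen s] from [c], and in the second case an [s]-neighbour of [q] is opposite to [c]. *)
Lemma Gamma_vertexP e (c : C e) s Q : Gamma_vertex s c Q ->
  exists2 y, opp_chambers c y & Q = panel d s y.
Proof.
move=> [_ [J [cJ QJ [p [q [cp Qq pq]]]]]].
have def_J := residue_panel_type (dB _) cJ; rewrite def_J in QJ.
have def_Q := is_residue_eq (dB _) QJ Qq.
have cq : codist c q = 1 \/ codist c q = gen s.
  move: cp => /(panelP (dB _))[->|/(dist_gen_sym (dB _)) pc]; first by left.
  by case: (codist_adjacentl q pc) => ->; rewrite pq ?mulg1; [left|right].
case: cq => cq; first by exists q.
have [y [qy cy]] := tw_codist_ex c q s.
exists y; first by rewrite /opp_chambers /= cy cq gen_mul.
rewrite def_Q /panel (residue_eq (dB _) (y := y) (x := q)) //.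
by apply/(panelP (dB _)); right.
Qed.

(* The common end of the two paths is the projection of the panel of [c] to the
   rank 2 residue of type [{s, t}]. *)
Lemma Gamma_edge_adjacent e (c : C e) s t y y' : two_spherical W -> s != t ->
    opp_chambers c y -> opp_chambers c y' -> d y y' = gen t ->
  Gamma_edge s c (panel d s y) (panel d s y').
Proof.
move=> W2sph st cy cy' yy'; set J := [set s; t]%SET.
have [n o_st] := W2sph s t; have sphJ : spherical J := spherical_set2 o_st.
have [sJ tJ] : s \in J /\ t \in J by rewrite !inE !eqxx orbT.
have [s' s'J def_s'] := longest_conj sphJ sJ.
have [z yz cz] := codist_parabolic_ex c y (longest_parabolic sphJ).
have {}cz : codist c z = longest J by rewrite cz cy mul1g.
have y'z : residue d J y' z.
  rewrite (residue_eq (dB _) (y := y') (x := y)) //.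
  by rewrite /residue /= yy'; exact: parabolic_gen.
(* The two paths end in the same panel and differ only in their first one, so a single argument
   serves [y] and [y']. *)
suff edge x : opp_chambers c x -> residue d J x z ->
    panel_compatible_path (panel d s c) [:: panel d s x; panel d s' z] [:: J].
  exists (panel d s' z), [:: panel d s y; panel d s' z],
    [:: panel d s y'; panel d s' z], [:: J]; split; first exact: is_panel_panel.
  - by split=> //; exact: edge.
  - by split=> //; exact: edge.
move=> cx xz; have def_R := residue_eq (dB _) xz.
have adj : adjacent_in (@tw_dist W D _) J (residue d J z) (panel d s x) (panel d s' z).
  split; [exact: is_panel_panel | exact: is_panel_panel | by rewrite cards2 st |].
  split=> //; [by exists z | | exact: (panel_sub_residue (dB _) s'J) |].
    by rewrite def_R; exact: (panel_sub_residue (dB _) sJ).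
  exists [set s]%SET, [set s']%SET; split; [by exists x | by exists z | |].
    exists x, z; split; [exact: residue_refl (dB _) _ _.. |].
    have zx : residue d J z x by rewrite def_R; exact: residue_refl (dB _) _ _.
    (* As [x] is opposite to [c], this reads [1 = longest J * d z x], so [x] and [z] are opposite in
       the residue. *)
    have := codist_longest sphJ cz zx; rewrite cx => /(canLR (mulKg _)).
    by rewrite mulg1 (dist_sym (dB _) x z) => /invg_inj <-.
  apply/seteqP; split=> w /= [q]; rewrite inE => /eqP -> <-.
    exists s'; first by rewrite /= inE.
    by rewrite def_s' !mulgA longest_mul // mul1g -mulgA longest_mul // mulg1.
  by exists s; rewrite /= ?inE // def_s' !mulgA longest_mul // mul1g -mulgA
    longest_mul // mulg1.
split.
- split=> //.
    by case=> [|[|]] // _; exact: is_panel_panel.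
  case=> // _; exists (residue d J z); split=> //=.
  by rewrite def_R; apply: (proj_set_id (dB _)); exact: (panel_sub_residue (dB _) sJ).
- by have [] := Gamma_vertex_panel s cx.
case=> // _; exists (residue d J z); split=> //=.
exact: coproj_panel.
Qed.

End TwinBuilding.

Theorem corollary5 (W : coxeterSystem) (D : twinBuilding W)
    (W2sph : two_spherical W) (Dthick : thick D) (Dco : condition_co D) :
  wall_connected D.
Proof.
move=> e c s _ _ /Gamma_vertexP[x cx ->] /Gamma_vertexP[y cy ->].
have dB := tw_building D.
have [k [p [<- <- opp_p adj_p]]] := Dco e c x y cx cy.
exists k, (fun i => panel (@tw_dist W D _) s (p i)); split=> // i.
  by move=> /opp_p; exact: Gamma_vertex_panel.
move=> lt_ik; have := opp_p i.+1 lt_ik; have := opp_p i (ltnW lt_ik).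
have [t] := adj_p i lt_ik; move: (p i) (p i.+1) => y1 y2.
(* If [y1 = y2] or [t = s], both chambers lie in the same [s]-panel and the trivial edge
   suffices. *)
move=> /(panelP (dB _))[<-|y12] c1 c2.
  by apply: Gamma_edge_refl; exact: Gamma_vertex_panel.
have [ts|st] := eqVneq s t; last exact: Gamma_edge_adjacent y12.
rewrite -ts in y12; rewrite /panel (residue_eq (dB _) (x := y1) (y := y2)).
  by apply: Gamma_edge_refl; exact: Gamma_vertex_panel.
by apply/(panelP (dB _)); right.
Qed.
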